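(* A two-dimensional solvable subalgebra of $\mathfrak{sp}(4,\mathbb{C})$ containing $T_{0,1}$ or $T_{1,0}$ is equivalent to one of the following: $$\mathfrak{t},\qquad \langle T_{1,0},X_{\alpha}\rangle,\qquad \langle T_{1,0},X_{\beta}\rangle,\qquad \langle T_{1,0},X_{\alpha+2\beta}\rangle .$$ These algebras are all pairwise inequivalent. The algebra $\langle T_{1,0},X_{\alpha}\rangle$ is abelian.
   Context: Let $J=\begin{pmatrix}0&0&1&0\\0&0&0&1\\-1&0&0&0\\0&-1&0&0\end{pmatrix}$. $\mathfrak{sp}(4,\mathbb{C})$ is the Lie algebra of $4\times4$ complex matrices $X$ with $JX^tJ=X$, and $Sp(4,\mathbb{C})=\{g\in GL(4,\mathbb{C}) : gJg^t=J\}$, acting on $\mathfrak{sp}(4,\mathbb{C})$ by conjugation $X\mapsto gXg^{-1}$. For $a,b\in\mathbb{C}$, $T_{a,b}=\mathrm{diag}(a,b,-a,-b)$, and $\mathfrak{t}=\{T_{a,b}: a,b\in\mathbb{C}\}$. With $E_{ij}$ the matrix units, $X_\alpha=E_{24}$, $X_\beta=E_{12}-E_{43}$, $X_{\alpha+2\beta}=E_{13}$. $\langle\,\cdot\,\rangle$ denotes the complex linear span. Two subalgebras are equivalent if some $g\in Sp(4,\mathbb{C})$ conjugates one onto the other. *)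

(* Defs.v *)
From HB Require Import structures.
From mathcomp Require Import all_boot all_order all_algebra.

Set Implicit Arguments.
Unset Strict Implicit.
Unset Printing Implicit Defensive.

Import GRing.Theory.
Local Open Scope ring_scope.

Definition lie (F : fieldType) (n : nat) (X Y : 'M[F]_n) : 'M[F]_n :=
  X *m Y - Y *m X.

Definition lie_closed (F : fieldType) (n : nat) (L : {vspace 'M[F]_n}) : Prop :=
  {in L &, forall X Y, lie X Y \in L}.

Definition lie_abelian (F : fieldType) (n : nat) (L : {vspace 'M[F]_n}) : Prop :=
  {in L &, forall X Y, lie X Y = 0}.

(* [L, L], the span of all brackets, encoded through a basis as [prodv] in
   [falgebra]; [lie_derivedP] is the characterisation free of the basis. *)
Definition lie_derived (F : fieldType) (n : nat) (L : {vspace 'M[F]_n}) :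
    {vspace 'M[F]_n} :=
  <<[seq lie X Y | X <- vbasis L, Y <- vbasis L]>>%VS.

Definition lie_solvable (F : fieldType) (n : nat) (L : {vspace 'M[F]_n}) : Prop :=
  exists k, iter k (@lie_derived F n) L = 0%VS.

Definition J4 (F : fieldType) : 'M[F]_4 :=
  \matrix_(i, j) nth 0 (nth [::] [:: [:: 0; 0; 1; 0];
                                     [:: 0; 0; 0; 1];
                                     [:: -1; 0; 0; 0];
                                     [:: 0; -1; 0; 0]] i) j.

Definition sp4 (F : fieldType) : {pred 'M[F]_4} :=
  [pred X | J4 F *m X^T *m J4 F == X].

Definition Sp4 (F : fieldType) : {pred 'M[F]_4} :=
  [pred g | (g \in unitmx) && (g *m J4 F *m g^T == J4 F)].

Arguments sp4 : clear implicits.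
Arguments Sp4 : clear implicits.

Definition sp4_subalgebra (F : fieldType) (L : {vspace 'M[F]_4}) : Prop :=
  {subset L <= sp4 F} /\ lie_closed L.

Definition conjmx_lin (F : fieldType) (g : 'M[F]_4) : 'End('M[F]_4) :=
  linfun (mulmxr (invmx g) \o mulmx g).

Definition Sp4_equiv (F : fieldType) (L M : {vspace 'M[F]_4}) : Prop :=
  exists2 g, g \in Sp4 F & (conjmx_lin g @: L)%VS = M.

Definition Tab (F : fieldType) (a b : F) : 'M[F]_4 :=
  diag_mx (\row_i [:: a; b; - a; - b]`_i).

(* Rows and columns are numbered from 0, so E_24 is [delta_mx 1 3]. *)
Definition X_alpha (F : fieldType) : 'M[F]_4 := delta_mx 1 3.
Definition X_beta (F : fieldType) : 'M[F]_4 := delta_mx 0 1 - delta_mx 3 2.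
Definition X_alpha_2beta (F : fieldType) : 'M[F]_4 := delta_mx 0 2.

(* {T_(a,b)}, see [memv_tt]. *)
Definition tt4 (F : fieldType) : {vspace 'M[F]_4} :=
  <<[:: Tab 1 0; Tab 0 1 : 'M[F]_4]>>%VS.

Section Sanity.
Variable F : fieldType.

Lemma lie_derivedP n (L V : {vspace 'M[F]_n}) :
  (lie_derived L <= V)%VS <-> {in L &, forall X Y, lie X Y \in V}.
Proof.
split=> [/subvP sLV X Y LX LY|LV]; last first.
  by apply/span_subvP => _ /allpairsP[[X Y] /= [? ? ->]]; apply: LV;
    apply: vbasis_mem.
apply: sLV; rewrite (coord_vbasis LX) /lie mulmx_suml mulmx_sumr -sumrB.
rewrite memv_suml // => j _; rewrite (coord_vbasis LY) mulmx_suml mulmx_sumr.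
rewrite -sumrB memv_suml // => i _.
rewrite -!scalemxAl -!scalemxAr !scalerA [X in _ - X *: _]mulrC -scalerBr.
by rewrite memvZ // memv_span //; apply: allpairs_f; rewrite mem_nth // size_tuple.
Qed.

Lemma conjmx_linE (g X : 'M[F]_4) : conjmx_lin g X = g *m X *m invmx g.
Proof. by rewrite lfunE. Qed.

Lemma TabE (a b : F) : Tab a b = a *: Tab 1 0 + b *: Tab 0 1.
Proof.
apply/matrixP=> i j; rewrite !mxE.
have [_|_] := eqVneq i j; last by rewrite !mulr0n !mulr0 addr0.
case: i => [[|[|[|[|//]]]] ?] /=;
  by rewrite ?mulr1n ?oppr0 ?mulrN ?mulr1 ?mulr0 ?add0r ?addr0.
Qed.

Lemma memv_tt (X : 'M[F]_4) :
  X \in tt4 F <-> exists a b, X = Tab a b.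
Proof.
rewrite /tt4 span_cons span_seq1; split=> [/memv_addP[_ /vlineP[a ->]]|].
  by case=> _ /vlineP[b ->] ->; exists a, b; rewrite (TabE a b).
by case=> a [b ->]; rewrite (TabE a b) memv_add // memvZ // memv_line.
Qed.

End Sanity.

(* Main.v *)
(* Conjugating by a coordinate swap, we may assume T_(1,0) lies in L.  Modulo
   T_(1,0), the algebra is spanned by an eigenvector Y of ad T_(1,0), with
   eigenvalue 0, 1, -1, 2 or -2.  The weight 0 vectors form a copy of sl_2, where
   Y is conjugate to a multiple of T_(0,1) or X_alpha; the weight 1 vectors form
   the standard representation of SL_2, on which SL_2 acts transitively off 0;
   weight 2 is a line; and a Weyl element of the other SL_2 swaps the signs.
   Inequivalence: t has no nonzero nilpotent element, only <T_(1,0), X_alpha>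
   is abelian among the other three, and the last two have derived algebras
   spanned by matrices of rank 2 and 1. *)
Require Import Defs.
From mathcomp Require Import all_boot all_order all_algebra.
From mathcomp Require Import ring.
From mathcomp Require Import reals.
From mathcomp Require Import complex.
Set Implicit Arguments.
Unset Strict Implicit.
Unset Printing Implicit Defensive.
Import GRing.Theory Num.Theory.
Local Open Scope ring_scope.

Section Field.
Variable F : fieldType.
Implicit Types (L M : {vspace 'M[F]_4}) (g X Y P Q : 'M[F]_4).

(** * Explicit computation with 4 x 4 matrices *)

(** Matrices are given by their rows, so that products and sums compute and a matrix identity splits
    into sixteen scalar ones for [ring] or [field]. *)
Definition mx4 (s : seq (seq F)) : 'M[F]_4 := \matrix_(i, j) nth 0 (nth [::] s i) j.

Lemma mulmx4 (s t : seq (seq F)) : mx4 s *m mx4 t =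
  mx4 (mkseq (fun i => mkseq (fun j => let r := nth [::] s i in
    nth 0 r 0 * nth 0 (nth [::] t 0) j + nth 0 r 1 * nth 0 (nth [::] t 1) j
    + nth 0 r 2 * nth 0 (nth [::] t 2) j + nth 0 r 3 * nth 0 (nth [::] t 3) j) 4) 4).
Proof.
apply/matrixP => i j; rewrite !mxE !big_ord_recl big_ord0 !mxE.
by rewrite !nth_mkseq // addr0 !addrA.
Qed.

Lemma trmx4 (s : seq (seq F)) :
  (mx4 s)^T = mx4 (mkseq (fun i => mkseq (fun j => nth 0 (nth [::] s j) i) 4) 4).
Proof. by apply/matrixP => i j; rewrite !mxE !nth_mkseq. Qed.

Lemma scalemx4 (a : F) (s : seq (seq F)) :
  a *: mx4 s = mx4 (mkseq (fun i => mkseq (fun j => a * nth 0 (nth [::] s i) j) 4) 4).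
Proof. by apply/matrixP => i j; rewrite !mxE !nth_mkseq. Qed.

Lemma addmx4 (s t : seq (seq F)) : mx4 s + mx4 t =
  mx4 (mkseq (fun i => mkseq (fun j => nth 0 (nth [::] s i) j
    + nth 0 (nth [::] t i) j) 4) 4).
Proof. by apply/matrixP => i j; rewrite !mxE !nth_mkseq. Qed.

Lemma oppmx4 (s : seq (seq F)) :
  - mx4 s = mx4 (mkseq (fun i => mkseq (fun j => - nth 0 (nth [::] s i) j) 4) 4).
Proof. by apply/matrixP => i j; rewrite !mxE !nth_mkseq. Qed.

Lemma mx4_eta X : X =
  mx4 (mkseq (fun i => mkseq (fun j => X (inord i) (inord j)) 4) 4).
Proof. by apply/matrixP => i j; rewrite !mxE !nth_mkseq // !inord_val. Qed.

Ltac congr_mx4 := rewrite /mkseq /=; congr mx4;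
  congr [:: [:: _; _; _; _]; [:: _; _; _; _]; [:: _; _; _; _]; [:: _; _; _; _]].

Lemma J4E : J4 F =
  mx4 [:: [:: 0; 0; 1; 0]; [:: 0; 0; 0; 1]; [:: -1; 0; 0; 0]; [:: 0; -1; 0; 0]].
Proof. by []. Qed.

Lemma Tab4E a b : Tab a b =
  mx4 [:: [:: a; 0; 0; 0]; [:: 0; b; 0; 0]; [:: 0; 0; - a; 0]; [:: 0; 0; 0; - b]].
Proof. by apply/matrixP => -[[|[|[|[|//]]]] ?] [[|[|[|[|//]]]] ?]; rewrite !mxE. Qed.

Lemma X_alpha4E : X_alpha F =
  mx4 [:: [:: 0; 0; 0; 0]; [:: 0; 0; 0; 1]; [:: 0; 0; 0; 0]; [:: 0; 0; 0; 0]].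
Proof. by apply/matrixP => -[[|[|[|[|//]]]] ?] [[|[|[|[|//]]]] ?]; rewrite !mxE. Qed.

Lemma X_beta4E : X_beta F =
  mx4 [:: [:: 0; 1; 0; 0]; [:: 0; 0; 0; 0]; [:: 0; 0; 0; 0]; [:: 0; 0; -1; 0]].
Proof.
by apply/matrixP => -[[|[|[|[|//]]]] ?] [[|[|[|[|//]]]] ?]; rewrite !mxE /= ?subr0 ?sub0r.
Qed.

Lemma X_alpha_2beta4E : X_alpha_2beta F =
  mx4 [:: [:: 0; 0; 1; 0]; [:: 0; 0; 0; 0]; [:: 0; 0; 0; 0]; [:: 0; 0; 0; 0]].
Proof. by apply/matrixP => -[[|[|[|[|//]]]] ?] [[|[|[|[|//]]]] ?]; rewrite !mxE. Qed.

Definition mx4E := (J4E, Tab4E, X_alpha4E, X_beta4E, X_alpha_2beta4E,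
  mulmx4, trmx4, scalemx4, addmx4, oppmx4).

(** Reads a scalar equation off a matrix identity; the side equations on [x] and [y] are left to
    [ring], so it can be stated in simplified form. *)
Lemma mx4_entry (s t : seq (seq F)) i j x y :
  mx4 s = mx4 t -> (i < 4)%N -> (j < 4)%N ->
  x = nth 0 (nth [::] s i) j -> y = nth 0 (nth [::] t i) j -> x = y.
Proof.
move=> eqst i4 j4 -> ->; move/matrixP/(_ (Ordinal i4) (Ordinal j4)): eqst.
by rewrite !mxE.
Qed.

Ltac mx4_at eqs i j :=
  apply: (mx4_entry (i := i) (j := j) eqs); rewrite // /mkseq /=; ring.

(* The embedding of SL_2 x SL_2 acting on the symplectic planes <e_0, e_2> and
   <e_1, e_3>. *)
Definition dsum2 (a b c d a' b' c' d' : F) := mx4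
  [:: [:: a; 0; b; 0]; [:: 0; a'; 0; b'];
      [:: c; 0; d; 0]; [:: 0; c'; 0; d']].

(** * Symplectic matrices and equivalence of subalgebras *)

Lemma mulJJ4 : J4 F *m J4 F = - 1%:M.
Proof.
rewrite !mx4E; apply/matrixP => -[[|[|[|[|//]]]] ?] [[|[|[|[|//]]]] ?];
by rewrite !mxE /=; ring.
Qed.

(** Invertibility is automatic: since J^2 = -1, the matrix -J g^T J is a right inverse of g. *)
Lemma Sp4I g : g *m J4 F *m g^T = J4 F -> g \in Sp4 F.
Proof.
move=> gJ; rewrite inE gJ eqxx andbT.
suff : g *m (- (J4 F *m g^T *m J4 F)) = 1%:M by case/mulmx1_unit.
by rewrite mulmxN !mulmxA gJ mulJJ4 opprK.
Qed.

(** Both blocks have determinant 1; the equations have a monomial on the left so that [ring] can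
    rewrite with them. *)
Lemma dsum2_Sp4 (a b c d a' b' c' d' : F) :
  a * d = 1 + b * c -> a' * d' = 1 + b' * c' ->
  dsum2 a b c d a' b' c' d' \in Sp4 F.
Proof.
move=> det1 det1'; apply: Sp4I; rewrite /dsum2 !mx4E.
by congr_mx4; ring: det1 det1'.
Qed.

Lemma Sp4M g h : g \in Sp4 F -> h \in Sp4 F -> g *m h \in Sp4 F.
Proof.
case/andP=> _ /eqP gJ /andP[_ /eqP hJ]; apply: Sp4I.
by rewrite -[RHS]gJ -[in RHS]hJ trmx_mul !mulmxA.
Qed.

Lemma Sp4_equiv_trans L M N : Sp4_equiv L M -> Sp4_equiv M N -> Sp4_equiv L N.
Proof.
case=> g gSp <- [h hSp <-]; exists (h *m g); first exact: Sp4M.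
have [gu hu] : g \in unitmx /\ h \in unitmx by case/andP: gSp; case/andP: hSp.
rewrite -limg_comp; congr (_ @: _)%VS; apply/lfunP => X.
rewrite comp_lfunE !conjmx_linE !mulmxA -!mulmxA; congr (_ *m (_ *m (_ *m _))).
exact: (@invrM 'M[F]_4 h g hu gu).
Qed.

(** The image of [L] contains the free pair [P'], [Q'] and has dimension at most 2, so it is their
    span. The intertwining form of the hypotheses keeps [invmx g] out of the computations. *)
Lemma Sp4_equiv_span L g P Q P' Q' :
  g \in Sp4 F -> (\dim L <= 2)%N -> free [:: P'; Q'] ->
  P \in L -> Q \in L -> g *m P = P' *m g -> g *m Q = Q' *m g ->
  Sp4_equiv L <<[:: P'; Q']>>%VS.
Proof.
move=> gSp dimL freePQ LP LQ gP gQ; exists g => //.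
have gu : g \in unitmx by case/andP: gSp.
apply/esym/eqP; rewrite eqEdim (eqP freePQ); apply/andP; split; last first.
  by rewrite (leq_trans _ dimL) // -(limg_ker_dim (conjmx_lin g) L) leq_addl.
have img X X' : X \in L -> g *m X = X' *m g -> X' \in (conjmx_lin g @: L)%VS.
  by move=> LX gX; rewrite -(mulmxK gu X') -gX -conjmx_linE memv_img.
by apply/span_subvP => Z; rewrite !inE => /orP[]/eqP->; [apply: img gP|apply: img gQ].
Qed.

Lemma lie_conj g X Y : g \in unitmx ->
  lie (g *m X *m invmx g) (g *m Y *m invmx g) = g *m lie X Y *m invmx g.
Proof. by move=> gu; rewrite /lie mulmxBr mulmxBl !mulmxA !mulmxKV. Qed.

(** The relation g J g^T = J yields J g^(-T) = g J and g^T J = J g^(-1), which carry J X^T J = X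
    over to the conjugate of X. *)
Lemma sp4_subalgebra_equiv L M : Sp4_equiv L M -> sp4_subalgebra L -> sp4_subalgebra M.
Proof.
case=> g /andP[gu /eqP gJ] <- [Lsp Llie]; split=> [Z|Z1 Z2].
  case/memv_imgP=> X /Lsp; rewrite !inE conjmx_linE => /eqP spX ->.
  rewrite !trmx_mul -{2}spX.
  have gtJ : J4 F *m (invmx g)^T = g *m J4 F.
    by apply: (can_inj (mulmxK (_ : g^T \in unitmx)));
      rewrite ?unitmx_tr // -mulmxA -trmx_mul mulmxV // trmx1 mulmx1.
  have gJt : g^T *m J4 F = J4 F *m invmx g.
    have -> : invmx g = - (J4 F *m g^T *m J4 F).
      by rewrite -[LHS]mulmx1 -[1%:M]opprK -mulJJ4 mulmxN mulmxA -{1}gJ -!mulmxA mulKmx.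
    by rewrite mulmxN !mulmxA mulJJ4 !mulNmx mul1mx opprK.
  by rewrite !mulmxA gtJ -!mulmxA gJt.
case/memv_imgP=> X LX -> /memv_imgP[Y LY ->].
by rewrite !conjmx_linE lie_conj // -conjmx_linE memv_img // Llie.
Qed.

(** * Coordinates on sp(4) and free pairs *)

(** This is the block form (A, B; C, -A^T) with B and C symmetric. *)
Lemma sp4_mx4 X : X \in sp4 F -> exists a b c d p q r s t u, X = mx4
  [:: [:: a; b; p; q]; [:: c; d; q; r]; [:: s; t; - a; - c]; [:: t; u; - b; - d]].
Proof.
rewrite inE => /eqP spX; pose x i j := X (inord i) (inord j).
have eqx := esym spX; rewrite [X]mx4_eta !mx4E in eqx.
exists (x 0 0)%N, (x 0 1)%N, (x 1 0)%N, (x 1 1)%N, (x 0 2)%N, (x 0 3)%N, (x 1 3)%N,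
  (x 2 0)%N, (x 2 1)%N, (x 3 1)%N.
rewrite [LHS]mx4_eta {}/x; congr_mx4 => //.
- mx4_at eqx 1%N 2%N.
- mx4_at eqx 2%N 2%N.
- mx4_at eqx 2%N 3%N.
- mx4_at eqx 3%N 0%N.
- mx4_at eqx 3%N 2%N.
- mx4_at eqx 3%N 3%N.
Qed.

Lemma sub_line_dim2 L X : \dim L = 2 -> X \in L -> X != 0 ->
  exists Y, Y \notin <[X]>%VS /\ L = (<[X]> + <[Y]>)%VS.
Proof.
move=> dimL LX X0.
have [|Y LY YX] := @subvPn _ _ L <[X]>%VS _.
  by apply/negP => /dimvS; rewrite dimL dim_vline X0.
exists Y; split=> //; have fr : free [:: X; Y].
  by rewrite (perm_free (permEl (perm_rot 1 [:: Y; X]))) free_cons span_seq1 YX seq1_free.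
rewrite -[X in (_ + X)%VS]span_seq1 -span_cons; apply/esym/eqP.
rewrite eqEdim (eqP fr) dimL andbT.
by apply/span_subvP => Z; rewrite !inE => /orP[]/eqP->.
Qed.

Lemma mx4_0 : mx4 (nseq 4 (nseq 4 0)) = 0.
Proof. by apply/matrixP => -[[|[|[|[|//]]]] ?] [[|[|[|[|//]]]] ?]; rewrite !mxE. Qed.

Lemma free_Tab10 X : X != 0 -> X 0 0 = 0 -> free [:: Tab 1 0; X].
Proof.
move=> X0 X00; rewrite free_cons span_seq1 seq1_free X0 andbT.
apply/vlineP => -[k /matrixP/(_ 0 0)/eqP].
by rewrite !mxE X00 mulr0 eqxx mulr1n oner_eq0.
Qed.

Lemma free_tt : free [:: Tab 1 0; Tab 0 1 : 'M[F]_4].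
Proof.
apply: free_Tab10; last by rewrite !mxE mul0rn.
by apply/eqP => /matrixP/(_ 1 1)/eqP; rewrite !mxE eqxx mulr1n oner_eq0.
Qed.

Lemma X_alpha_neq0 : X_alpha F != 0.
Proof.
rewrite X_alpha4E; apply/eqP => /matrixP/(_ 1 (inord 3))/eqP.
by rewrite !mxE inordK // oner_eq0.
Qed.

Lemma X_beta_neq0 : X_beta F != 0.
Proof. by apply/eqP => /matrixP/(_ 0 1)/eqP; rewrite !mxE /= subr0 oner_eq0. Qed.

Lemma X_alpha_2beta_neq0 : X_alpha_2beta F != 0.
Proof.
rewrite X_alpha_2beta4E; apply/eqP => /matrixP/(_ 0 (inord 2))/eqP.
by rewrite !mxE inordK // oner_eq0.
Qed.

Lemma free_alpha : free [:: Tab 1 0; X_alpha F].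
Proof. by apply: free_Tab10 X_alpha_neq0 _; rewrite !mxE. Qed.

Lemma free_beta : free [:: Tab 1 0; X_beta F].
Proof. by apply: free_Tab10 X_beta_neq0 _; rewrite !mxE subr0. Qed.

Lemma free_alpha_2beta : free [:: Tab 1 0; X_alpha_2beta F].
Proof. by apply: free_Tab10 X_alpha_2beta_neq0 _; rewrite !mxE. Qed.

(** * Normal forms, weight by weight *)

(** Completes a nonzero row (a, b) to a matrix of SL_2 with second row (x, y); this is the
    transitivity of SL_2 used for weights 1 and -1. *)
Lemma SL2_row (a b : F) : (a != 0) || (b != 0) -> exists x y, a * y = 1 + b * x.
Proof.
have [-> /= b0|a0 _] := eqVneq a 0; first by exists (- b^-1), 0; field.
by exists 0, a^-1; field.
Qed.

Lemma alpha_2beta_equiv L Y p : (\dim L <= 2)%N -> Tab 1 0 \in L -> Y \in L ->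
  p != 0 ->
  Y = mx4 [:: [:: 0; 0; p; 0]; [:: 0; 0; 0; 0]; [:: 0; 0; 0; 0]; [:: 0; 0; 0; 0]] ->
  Sp4_equiv L <<[:: Tab 1 0; X_alpha_2beta F]>>%VS.
Proof.
move=> dimL LT LY p0 YE.
have gSp : dsum2 1 0 0 1 1 0 0 1 \in Sp4 F by apply: dsum2_Sp4; ring.
have LQ : p^-1 *: Y \in L by rewrite rpredZ.
apply: (Sp4_equiv_span gSp dimL free_alpha_2beta LT LQ); rewrite /dsum2 ?YE !mx4E.
  by congr_mx4; ring.
by congr_mx4; field.
Qed.

Lemma opp_alpha_2beta_equiv L Y p : (\dim L <= 2)%N -> Tab 1 0 \in L -> Y \in L ->
  p != 0 ->
  Y = mx4 [:: [:: 0; 0; 0; 0]; [:: 0; 0; 0; 0]; [:: p; 0; 0; 0]; [:: 0; 0; 0; 0]] ->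
  Sp4_equiv L <<[:: Tab 1 0; X_alpha_2beta F]>>%VS.
Proof.
move=> dimL LT LY p0 YE.
have gSp : dsum2 0 1 (-1) 0 1 0 0 1 \in Sp4 F by apply: dsum2_Sp4; ring.
(* The Weyl element [g] of the first SL_2 negates T_(1,0) and sends E_31 to -E_13, hence this sign
   and the passage to -T_(1,0) in [LT]. *)
have LQ : - p^-1 *: Y \in L by rewrite rpredZ.
rewrite -rpredN in LT.
apply: (Sp4_equiv_span gSp dimL free_alpha_2beta LT LQ); rewrite /dsum2 ?YE !mx4E.
  by congr_mx4; ring.
by congr_mx4; field.
Qed.

Lemma beta_equiv L Y b q : (\dim L <= 2)%N -> Tab 1 0 \in L -> Y \in L ->
  (b != 0) || (q != 0) ->
  Y = mx4 [:: [:: 0; b; 0; q]; [:: 0; 0; q; 0]; [:: 0; 0; 0; 0]; [:: 0; 0; - b; 0]] ->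
  Sp4_equiv L <<[:: Tab 1 0; X_beta F]>>%VS.
Proof.
move=> dimL LT LY /SL2_row[x [y det1]] YE.
(* With (b, q) as first row of the second block, row 0 of [X_beta F *m g] is row 0 of [Y]; x and y
   only complete the determinant. *)
have gSp : dsum2 1 0 0 1 b q x y \in Sp4 F.
  by apply: dsum2_Sp4; rewrite ?det1; ring.
apply: (Sp4_equiv_span gSp dimL free_beta LT LY); rewrite /dsum2 ?YE !mx4E.
  by congr_mx4; ring.
by congr_mx4; ring: det1.
Qed.

Lemma opp_beta_equiv L Y c t : (\dim L <= 2)%N -> Tab 1 0 \in L -> Y \in L ->
  (t != 0) || (c != 0) ->
  Y = mx4 [:: [:: 0; 0; 0; 0]; [:: c; 0; 0; 0]; [:: 0; t; 0; - c]; [:: t; 0; 0; 0]] ->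
  Sp4_equiv L <<[:: Tab 1 0; X_beta F]>>%VS.
Proof.
rewrite -[c == 0]oppr_eq0 => dimL LT LY /SL2_row[x [y det1]] YE.
(* The first block moves row 2 of [Y], which is (0, t, 0, -c), to row 0, so (t, -c) takes the place
   of (b, q). *)
have gSp : dsum2 0 1 (-1) 0 t (- c) x y \in Sp4 F.
  by apply: dsum2_Sp4; rewrite ?det1; ring.
rewrite -rpredN in LT.
apply: (Sp4_equiv_span gSp dimL free_beta LT LY); rewrite /dsum2 ?YE !mx4E.
  by congr_mx4; ring.
by congr_mx4; ring: det1.
Qed.

(** The general element of the sl_2 acting on the plane <e_1, e_3>, which commutes with T_(1,0). *)
Definition sl2mx d r u := mx4
 [:: [:: 0; 0; 0; 0]; [:: 0; d; 0; r]; [:: 0; 0; 0; 0]; [:: 0; u; 0; - d]].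

(** The condition on [d], [r], [u] says that the sl_2 block has determinant 0, hence is nilpotent.
    If r = 0 only [u] survives and a Weyl element moves it to the place of [r]; otherwise a lower
    unipotent matrix clears [d] and [u]. *)
Lemma alpha_equiv L d r u : (\dim L <= 2)%N -> Tab 1 0 \in L -> sl2mx d r u \in L ->
  sl2mx d r u != 0 -> d * d = - (r * u) ->
  Sp4_equiv L <<[:: Tab 1 0; X_alpha F]>>%VS.
Proof.
move=> dimL LT LY Y0 det0; have [r0|r0] := eqVneq r 0.
  have d0 : d = 0 by apply/eqP; rewrite -[_ == _]orbb -mulf_eq0 det0 r0 mul0r oppr0.
  have u0 : u != 0 by apply: contraNneq Y0 => u0; rewrite /sl2mx r0 d0 u0 oppr0 mx4_0.
  have gSp : dsum2 1 0 0 1 0 1 (-1) 0 \in Sp4 F by apply: dsum2_Sp4; ring.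
  have LQ : - u^-1 *: sl2mx d r u \in L by rewrite rpredZ.
  apply: (Sp4_equiv_span gSp dimL free_alpha LT LQ); rewrite /dsum2 /sl2mx ?r0 ?d0 !mx4E.
    by congr_mx4; ring.
  by congr_mx4; field.
have gSp : dsum2 1 0 0 1 1 0 (d / r) 1 \in Sp4 F by apply: dsum2_Sp4; ring.
have LQ : r^-1 *: sl2mx d r u \in L by rewrite rpredZ.
have uE : u = - (d * d) / r by rewrite det0; field.
apply: (Sp4_equiv_span gSp dimL free_alpha LT LQ); rewrite /dsum2 /sl2mx ?uE !mx4E.
  by congr_mx4; ring.
by congr_mx4; field.
Qed.

(** The block has eigenvalues x and -x, distinct since 2x is nonzero. The second block of the
    conjugating matrix has left eigenvectors as rows, scaled to determinant 1. *)
Lemma tt_equiv L d r u x : (\dim L <= 2)%N -> Tab 1 0 \in L -> sl2mx d r u \in L ->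
  x != 0 -> x * x = d * d + r * u -> 2 != 0 :> F ->
  Sp4_equiv L (tt4 F).
Proof.
move=> dimL LT LY x0 xE two0.
have LQ y : y *: sl2mx d r u \in L by rewrite rpredZ.
have [r0|r0] := eqVneq r 0.
  have d0 : d != 0.
    apply: contra_neq x0 => d0; apply/eqP.
    by rewrite -[_ == _]orbb -mulf_eq0 xE r0 d0 !mul0r addr0.
  have gSp : dsum2 1 0 0 1 1 0 (- u / (2 * d)) 1 \in Sp4 F by apply: dsum2_Sp4; ring.
  apply: (Sp4_equiv_span gSp dimL free_tt LT (LQ d^-1)); rewrite /dsum2 /sl2mx ?r0 !mx4E.
    by congr_mx4; ring.
  by congr_mx4; field; rewrite ?two0 ?d0.
(* The rows are multiples of (d + x, r) and (d - x, r), left eigenvectors for x and -x, nonzero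
   because r is. *)
have gSp : dsum2 1 0 0 1 (x + d) r ((d - x) / (2 * r * x)) (2 * x)^-1 \in Sp4 F.
  by apply: dsum2_Sp4; field; rewrite ?two0 ?r0 ?x0.
have uE : u = (x * x - d * d) / r by rewrite xE; field.
apply: (Sp4_equiv_span gSp dimL free_tt LT (LQ x^-1)); rewrite /dsum2 /sl2mx ?uE !mx4E.
  by congr_mx4; ring.
by congr_mx4; field; rewrite ?two0 ?d0 ?x0 ?r0.
Qed.

(** * Reduction to a weight vector of ad T_(1,0) *)

Lemma Tab10_neq0 : Tab 1 0 != 0 :> 'M[F]_4.
Proof.
by apply/eqP => /matrixP/(_ 0 0)/eqP; rewrite !mxE eqxx mulr1n oner_eq0.
Qed.

(** The scalar equations spell out [T_(1,0), Y] = k Y: the weights are 1 for b, q; -1 for c, t; 0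
    for d, r, u; and 2, -2 for p, s. *)
Lemma Tab10_weight L : sp4_subalgebra L -> \dim L = 2 -> Tab 1 0 \in L ->
  exists2 Y, Y \in L & exists k b c d p q r s t u,
  [/\ Y = mx4
    [:: [:: 0; b; p; q]; [:: c; d; q; r]; [:: s; t; 0; - c]; [:: t; u; - b; - d]],
    Y != 0 &
   [/\ [/\ b = k * b, q = k * q, - c = k * c & - t = k * t],
    [/\ 0 = k * d, 0 = k * r & 0 = k * u] &
    [/\ p + p = k * p & - s - s = k * s] ]].
Proof.
move=> [Lsp Llie] dimL LT; have [Z [ZT LE]] := sub_line_dim2 dimL LT Tab10_neq0.
have LZ : Z \in L by rewrite LE memvE addvSr.
pose Y := Z - Z 0 0 *: Tab 1 0; have LY : Y \in L by rewrite rpredB ?rpredZ.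
have Y00 : Y 0 0 = 0 by rewrite !mxE eqxx mulr1n mulr1 subrr.
have Y0 : Y != 0.
  by apply: contraNneq ZT => /eqP; rewrite subr_eq0 => /eqP->; rewrite memvZ ?memv_line.
have [x [y TY]] : exists x y, lie (Tab 1 0) Y = x *: Tab 1 0 + y *: Y.
  have := Llie _ _ LT LY; rewrite {1}LE.
  move=> /memv_addP[_ /vlineP[x ->] [_ /vlineP[y ->] ->]].
  exists (x + y * Z 0 0), y; rewrite /Y scalerBr scalerA scalerDl addrACA.
  by rewrite subrr addr0.
exists Y => //; have [a [b [c [d [p [q [r [s [t [u YE]]]]]]]]]] := sp4_mx4 (Lsp _ LY).
have a0 : a = 0 by rewrite -Y00 YE mxE.
exists y, b, c, d, p, q, r, s, t, u.
rewrite a0 oppr0 in YE; split=> //.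
rewrite /lie {1 2 3}YE !mx4E in TY.
(* Brackets with a diagonal matrix have zero diagonal and [Y 0 0] vanishes, so entry (0, 0) isolates
   [x]. *)
have x0 : x = 0 by symmetry; mx4_at TY 0%N 0%N.
rewrite x0 in TY; do !split.
- mx4_at TY 0%N 1%N.
- mx4_at TY 0%N 3%N.
- mx4_at TY 1%N 0%N.
- mx4_at TY 2%N 1%N.
- mx4_at TY 1%N 1%N.
- mx4_at TY 1%N 3%N.
- mx4_at TY 3%N 1%N.
- mx4_at TY 0%N 2%N.
- mx4_at TY 2%N 0%N.
Qed.

Lemma mem_span2 P Q X : X \in <<[:: P; Q]>>%VS -> exists a b, X = a *: P + b *: Q.
Proof.
rewrite span_cons span_seq1 => /memv_addP[_ /vlineP[a ->] [_ /vlineP[b ->] ->]].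
by exists a, b.
Qed.

Lemma Sp4_equiv_dim L M : Sp4_equiv L M -> \dim M = \dim L.
Proof.
case=> g /andP[gu _] <-; apply: limg_dim_eq.
have /eqP-> : lker (conjmx_lin g) == 0%VS; last exact: capv0.
apply/lker0P => X Y.
by rewrite !conjmx_linE => /(can_inj (mulmxKV gu))/(can_inj (mulKmx gu)).
Qed.

Lemma swap_to_Tab10 L : Tab 0 1 \in L -> exists2 M, Sp4_equiv L M & Tab 1 0 \in M.
Proof.
move=> LT.
pose g := mx4
    [:: [:: 0; 1; 0; 0]; [:: 1; 0; 0; 0]; [:: 0; 0; 0; 1]; [:: 0; 0; 1; 0]].
have gSp : g \in Sp4 F by apply: Sp4I; rewrite /g !mx4E; congr_mx4; ring.
exists (conjmx_lin g @: L)%VS; first by exists g.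
have gT : g *m Tab 0 1 = Tab 1 0 *m g by rewrite /g !mx4E; congr_mx4; ring.
have gu : g \in unitmx by case/andP: gSp.
by rewrite -(mulmxK gu (Tab 1 0)) -gT -conjmx_linE memv_img.
Qed.

(** * Inequivalence of the four models *)

Lemma lie_abelian_equiv L M : Sp4_equiv L M -> lie_abelian L -> lie_abelian M.
Proof.
case=> g /andP[gu _] <- abL _ _ /memv_imgP[X LX ->] /memv_imgP[Y LY ->].
by rewrite !conjmx_linE lie_conj // abL // mulmx0 mul0mx.
Qed.

(** A square-zero [N] would be conjugate to a diagonal matrix of square zero, which vanishes. *)
Lemma tt_nequiv M N : N \in M -> N *m N = 0 -> N != 0 -> ~ Sp4_equiv (tt4 F) M.
Proof.
move=> MN N2 N0 [g /andP[gu _] gM].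
move: MN; rewrite -gM => /memv_imgP[_ /memv_tt[a [b ->]]]; rewrite conjmx_linE => NE.
have : Tab a b *m Tab a b = 0.
  apply: (can_inj (mulKmx gu)); apply: (can_inj (mulmxK (_ : invmx g \in unitmx))).
    by rewrite unitmx_inv.
  by rewrite mulmx0 mul0mx -N2 NE !mulmxA mulmxKV.
rewrite -mx4_0 !mx4E => ab0.
have /eqP : a * a = 0 by mx4_at ab0 0%N 0%N.
have /eqP : b * b = 0 by mx4_at ab0 1%N 1%N.
rewrite !mulf_eq0 !orbb => /eqP b0 /eqP a0; case/eqP: N0.
rewrite NE a0 b0 (_ : Tab 0 0 = 0) ?mulmx0 ?mul0mx //.
by rewrite TabE !scale0r addr0.
Qed.

Lemma sqr_X_alpha : X_alpha F *m X_alpha F = 0.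
Proof. by rewrite -mx4_0 !mx4E; congr_mx4; ring. Qed.

Lemma sqr_X_beta : X_beta F *m X_beta F = 0.
Proof. by rewrite -mx4_0 !mx4E; congr_mx4; ring. Qed.

Lemma sqr_X_alpha_2beta : X_alpha_2beta F *m X_alpha_2beta F = 0.
Proof. by rewrite -mx4_0 !mx4E; congr_mx4; ring. Qed.

Lemma lie_Tab10_alpha : lie (Tab 1 0) (X_alpha F) = 0.
Proof. by rewrite /lie -mx4_0 !mx4E; congr_mx4; ring. Qed.

Lemma lie_Tab10_beta : lie (Tab 1 0) (X_beta F) = X_beta F.
Proof. by rewrite /lie !mx4E; congr_mx4; ring. Qed.

Lemma lie_Tab10_alpha_2beta : lie (Tab 1 0) (X_alpha_2beta F) = 2 *: X_alpha_2beta F.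
Proof. by rewrite /lie !mx4E; congr_mx4; ring. Qed.

(** The bracket is alternating, so on a plane it is a determinant times [lie P Q]; brackets thus
    fill at most a line. *)
Lemma lie_span2 P Q a b c d :
  lie (a *: P + b *: Q) (c *: P + d *: Q) = (a * d - b * c) *: lie P Q.
Proof.
rewrite /lie !mulmxDl !mulmxDr -!scalemxAl -!scalemxAr !scalerA !scalerBr !scalerBl.
rewrite (mulrC c a) (mulrC d b) (mulrC d a) (mulrC c b).
by rewrite !opprD; apply/matrixP => i j; rewrite !mxE; ring.
Qed.

Lemma lie_abelian_alpha : lie_abelian <<[:: Tab 1 0; X_alpha F]>>%VS.
Proof.
move=> _ _ /mem_span2[a [b ->]] /mem_span2[c [d ->]].
by rewrite lie_span2 lie_Tab10_alpha scaler0.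
Qed.

(** Equivalence preserves commutativity, and an eigenvector [X] of nonzero weight does not commute
    with T_(1,0). *)
Lemma alpha_nequiv X k : X != 0 -> lie (Tab 1 0) X = k *: X -> k != 0 ->
  ~ Sp4_equiv <<[:: Tab 1 0; X_alpha F]>>%VS <<[:: Tab 1 0; X]>>%VS.
Proof.
move=> X0 TX k0 /lie_abelian_equiv/(_ lie_abelian_alpha) ab.
have /eqP : lie (Tab 1 0) X = 0 by apply: ab; rewrite memv_span // !inE eqxx ?orbT.
by rewrite TX scaler_eq0 (negbTE k0) (negbTE X0).
Qed.

Lemma beta_nequiv :
  ~ Sp4_equiv <<[:: Tab 1 0; X_beta F]>>%VS <<[:: Tab 1 0; X_alpha_2beta F]>>%VS.
Proof.
case=> g /andP[gu _] gM.
have gin X : X \in [:: Tab 1 0; X_beta F] ->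
    g *m X *m invmx g \in <<[:: Tab 1 0; X_alpha_2beta F]>>%VS.
  by move=> LX; rewrite -gM -conjmx_linE memv_img // memv_span.
have [|a [b TE]] := mem_span2 (gin (Tab 1 0) _); first by rewrite !inE eqxx.
have [|c [d XE]] := mem_span2 (gin (X_beta F) _); first by rewrite !inE eqxx orbT.
have := lie_conj (Tab 1 0) (X_beta F) gu.
rewrite TE XE lie_span2 lie_Tab10_alpha_2beta lie_Tab10_beta scalerA.
set k := _ * 2 => gX.
have {gX} : k *: (invmx g *m X_alpha_2beta F *m g) = X_beta F.
  by rewrite scalemxAl scalemxAr gX !mulmxA mulVmx // mul1mx mulmxKV.
(* X_beta is conjugate to a multiple of X_(alpha+2beta), so its 2x2 minors vanish. *)
pose G i j := g (inord i) (inord j); pose H i j := invmx g (inord i) (inord j).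
rewrite [g in _ *m g]mx4_eta [invmx _]mx4_eta !mx4E => XbE.
(* Entry (i, j) of the left side of [XbE] is [k * H i 0 * G 2 j]. The minor on rows 0, 3 and columns
   1, 2 is -1 for [X_beta], but 0 for such a product. *)
have e01 : k * H 0%N 0%N * G 2%N 1%N = 1 by rewrite /G /H; mx4_at XbE 0%N 1%N.
have e32 : k * H 3%N 0%N * G 2%N 2%N = -1 by rewrite /G /H; mx4_at XbE 3%N 2%N.
have e02 : k * H 0%N 0%N * G 2%N 2%N = 0 by rewrite /G /H; mx4_at XbE 0%N 2%N.
have /eqP : (-1 : F) = 0.
  transitivity ((k * H 0%N 0%N * G 2%N 1%N) * (k * H 3%N 0%N * G 2%N 2%N)).
    by rewrite e01 e32 mul1r.
  transitivity ((k * H 0%N 0%N * G 2%N 2%N) * (k * H 3%N 0%N * G 2%N 1%N)); first ring.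
  by rewrite e02 mul0r.
by rewrite oppr_eq0 oner_eq0.
Qed.
End Field.

(** * Classification over an algebraically closed field *)

Section ClosedField.
Variable F : numClosedFieldType.

(** Characteristic zero keeps the weights -2, ..., 2 distinct, so [k] selects the surviving
    coordinates of [Y]; closedness supplies the square root that diagonalises [Y] in weight 0. *)
Lemma Tab10_classification (L : {vspace 'M[F]_4}) : sp4_subalgebra L -> \dim L = 2 ->
  Tab 1 0 \in L ->
     Sp4_equiv L (tt4 F)
     \/ Sp4_equiv L <<[:: Tab 1 0; X_alpha F]>>%VS
     \/ Sp4_equiv L <<[:: Tab 1 0; X_beta F]>>%VS
     \/ Sp4_equiv L <<[:: Tab 1 0; X_alpha_2beta F]>>%VS.
Proof.
move=> Lsp dimL LT.
have [Y LY [k [b [c [d [p [q [r [s [t [u [YE Y0]]]]]]]]]]]] := Tab10_weight Lsp dimL LT.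
case=> -[eb eq ec et] [ed er eu] [ep es].
(* A coordinate of weight [m] vanishes unless k = m. Integer casts let [eqr_int] decide whether two
   weights differ. *)
have off (m : int) x : m%:~R * x = k * x -> k != m%:~R -> x = 0.
  move=> /eqP; rewrite eq_sym -subr_eq0 -mulrBl mulf_eq0 subr_eq0 => + km.
  by rewrite (negbTE km) => /eqP.
have {}eb : 1%:~R * b = k * b by rewrite -eb mul1r.
have {}eq : 1%:~R * q = k * q by rewrite -eq mul1r.
have {}ec : (- 1)%:~R * c = k * c by rewrite -ec; ring.
have {}et : (- 1)%:~R * t = k * t by rewrite -et; ring.
have {}ed : 0%:~R * d = k * d by rewrite -ed mul0r.
have {}er : 0%:~R * r = k * r by rewrite -er mul0r.
have {}eu : 0%:~R * u = k * u by rewrite -eu mul0r.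
have {}ep : 2%:~R * p = k * p by rewrite -ep; ring.
have {}es : (- 2)%:~R * s = k * s by rewrite -es; ring.
have dimL2 : (\dim L <= 2)%N by rewrite dimL.
have [k0|k0] := eqVneq k 0%:~R.
  have [b0 q0 p0] : [/\ b = 0, q = 0 & p = 0].
    by split; [apply: off eb _|apply: off eq _|apply: off ep _]; rewrite k0 eqr_int.
  have [c0 t0 s0] : [/\ c = 0, t = 0 & s = 0].
    by split; [apply: off ec _|apply: off et _|apply: off es _]; rewrite k0 eqr_int.
  rewrite {}b0 {}q0 {}p0 {}c0 {}t0 {}s0 oppr0 -/(sl2mx d r u) in YE.
  rewrite {}YE in LY Y0.
  (* Minus the determinant of the sl_2 block: zero in the nilpotent case, the square of an
     eigenvalue otherwise. *)
  have [D0|D0] := eqVneq (d * d + r * u) 0.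
    by right; left; apply: alpha_equiv LY Y0 _ => //; apply/eqP; rewrite -addr_eq0 D0.
  have x0 : sqrtC (d * d + r * u) != 0 by rewrite sqrtC_eq0.
  have x2 : sqrtC (d * d + r * u) * sqrtC (d * d + r * u) = d * d + r * u.
    by rewrite -expr2 sqrtCK.
  by left; apply: (tt_equiv dimL2 LT LY x0 x2); rewrite pnatr_eq0.
have [d0 r0 u0] : [/\ d = 0, r = 0 & u = 0].
  by split; [apply: off ed _|apply: off er _|apply: off eu _].
rewrite {}d0 {}r0 {}u0 oppr0 in YE.
have [k1|k1] := eqVneq k 1%:~R.
  right; right; left.
  have [p0 s0] : p = 0 /\ s = 0.
    by split; [apply: off ep _|apply: off es _]; rewrite k1 eqr_int.
  have [c0 t0] : c = 0 /\ t = 0.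
    by split; [apply: off ec _|apply: off et _]; rewrite k1 eqr_int.
  rewrite {}p0 {}s0 {}c0 {}t0 oppr0 in YE; apply: (beta_equiv dimL2 LT LY _ YE).
  apply: contraNT Y0; rewrite negb_or !negbK => /andP[/eqP b0 /eqP q0].
  by rewrite YE b0 q0 oppr0 mx4_0.
have [b0 q0] : b = 0 /\ q = 0 by split; [apply: off eb _|apply: off eq _].
rewrite {}b0 {}q0 oppr0 in YE.
have [kn1|kn1] := eqVneq k (- 1)%:~R.
  right; right; left.
  have [p0 s0] : p = 0 /\ s = 0.
    by split; [apply: off ep _|apply: off es _]; rewrite kn1 eqr_int.
  rewrite {}p0 {}s0 in YE; apply: (opp_beta_equiv dimL2 LT LY _ YE).
  apply: contraNT Y0; rewrite negb_or !negbK => /andP[/eqP t0 /eqP c0].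
  by rewrite YE t0 c0 oppr0 mx4_0.
have [c0 t0] : c = 0 /\ t = 0 by split; [apply: off ec _|apply: off et _].
rewrite {}c0 {}t0 oppr0 in YE; right; right; right.
have [p0|p0] := eqVneq p 0.
  rewrite p0 in YE; apply: (opp_alpha_2beta_equiv dimL2 LT LY _ YE).
  by apply: contraNneq Y0 => s0; rewrite YE s0 mx4_0.
have k2 : k = 2%:~R by apply/eqP; apply: contra_neqT p0; apply: off.
have s0 : s = 0 by apply: off es _; rewrite k2 eqr_int.
by rewrite s0 in YE; apply: alpha_2beta_equiv dimL2 LT LY p0 YE.
Qed.
End ClosedField.

Theorem lemma6p5 (R : realType) :
  (forall L : {vspace 'M[R[i]]_4},
     sp4_subalgebra L -> \dim L = 2%N -> lie_solvable L ->
     Tab (F := R[i]) 0 1 \in L \/ Tab (F := R[i]) 1 0 \in L ->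
     Sp4_equiv L (tt4 R[i])
     \/ Sp4_equiv L <<[:: Tab 1 0; X_alpha R[i]]>>%VS
     \/ Sp4_equiv L <<[:: Tab 1 0; X_beta R[i]]>>%VS
     \/ Sp4_equiv L <<[:: Tab 1 0; X_alpha_2beta R[i]]>>%VS)
  /\ (~ Sp4_equiv (tt4 R[i]) <<[:: Tab 1 0; X_alpha R[i]]>>%VS
      /\ ~ Sp4_equiv (tt4 R[i]) <<[:: Tab 1 0; X_beta R[i]]>>%VS
      /\ ~ Sp4_equiv (tt4 R[i]) <<[:: Tab 1 0; X_alpha_2beta R[i]]>>%VS
      /\ ~ Sp4_equiv <<[:: Tab 1 0; X_alpha R[i]]>>%VS
                     <<[:: Tab 1 0; X_beta R[i]]>>%VS
      /\ ~ Sp4_equiv <<[:: Tab 1 0; X_alpha R[i]]>>%VS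
                     <<[:: Tab 1 0; X_alpha_2beta R[i]]>>%VS
      /\ ~ Sp4_equiv <<[:: Tab 1 0; X_beta R[i]]>>%VS
                     <<[:: Tab 1 0; X_alpha_2beta R[i]]>>%VS)
  /\ lie_abelian <<[:: Tab 1 0; X_alpha R[i]]>>%VS.
Proof.
have mem2 (X : 'M[R[i]]_4) : X \in <<[:: Tab 1 0; X]>>%VS.
  by rewrite memv_span // !inE eqxx orbT.
split; [|split; last exact: lie_abelian_alpha].
  move=> L Lsp dimL _ [LT|]; last exact: Tab10_classification.
  have [M LM MT] := swap_to_Tab10 LT.
  have := Tab10_classification (sp4_subalgebra_equiv LM Lsp)
    (etrans (Sp4_equiv_dim LM) dimL) MT.
  by case=> [|[|[|]]] /(Sp4_equiv_trans LM); tauto.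
split; [|split; [|split; [|split; [|split]]]].
- exact: tt_nequiv (mem2 _) (sqr_X_alpha _) (X_alpha_neq0 _).
- exact: tt_nequiv (mem2 _) (sqr_X_beta _) (X_beta_neq0 _).
- exact: tt_nequiv (mem2 _) (sqr_X_alpha_2beta _) (X_alpha_2beta_neq0 _).
- apply: (alpha_nequiv (k := 1) (X_beta_neq0 _)); last exact: oner_neq0.
  by rewrite lie_Tab10_beta scale1r.
- apply: (alpha_nequiv (X_alpha_2beta_neq0 _) (lie_Tab10_alpha_2beta _)).
  by rewrite pnatr_eq0.
- exact: beta_nequiv.
Qed.
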